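(* Let $\mathbb K$ be a field of characteristic $0$, let $g,f\in\mathbb K[[t]]$ with $g(0)\neq0$ (where $f(0)$ may or may not be zero), let $(d_{n,k})_{n,k\ge0}=(g,f)$ be the Riordan type array with entries $d_{n,k}=[t^n]\,g f^k$, and let $(\tilde d_{n,k})_{n,k\ge0}=(g,tf)$, with $\tilde d_{n,k}=[t^n]\,g\,(tf)^k$, be the Riordan array associated with the Riordan type array $(g,f)$. Then: (a) There exists the $A$-sequence $(a_0,a_1,\ldots)$ for $(g,f)$ such that $$d_{n,k}=\sum_{j=0}^n a_j\,d_{n-j,k+j-1}\qquad (n\ge0,\ k\ge1),$$ or equivalently, the generating function $A(t)=\sum_{j\ge0}a_jt^j$ of the $A$-sequence satisfies $$A(tf)=f,\quad\text{or equivalently}\quad A(t)=\frac{t}{\overline{tf}},$$ where $\overline{tf}$ is the compositional inverse of $tf$. (b) There also exists the $Z$-sequence $(z_0,z_1,\ldots)$ for $(g,f)$ such that $$d_{n,0}=\sum_{j=0}^{n-1}z_j\,d_{n-j-1,j}\qquad (n\ge1),$$ or equivalently, the generating function $Z(t)=\sum_{j\ge0}z_jt^j$ of the $Z$-sequence satisfies $$g=\frac{d_{0,0}}{1-tZ(tf)}.$$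
   Context: $[t^n]F$ denotes the coefficient of $t^n$ in the formal power series $F$. $A(tf)$ and $Z(tf)$ denote the composition of $A$ and $Z$ with the series $t f(t)$. The compositional inverse $\overline{u}$ of a series $u$ is the series with $u(\overline u(t))=\overline u(u(t))=t$.
   Formalization: Existence of the A-sequence, the Z-sequence and the inverse of tf is stated only for f(0) ≠ 0, since it fails otherwise (g=1, f=t has no A-sequence; g=1/(1-t^2), f=t has no Z-sequence); the equivalences are stated for all f, the one with the inverse of tf for whatever inverse exists. *)

(* Defs.v *)
From HB Require Import structures.
From mathcomp Require Import all_boot all_order all_algebra.
From mathcomp Require Import boolp.

Set Implicit Arguments.
Unset Strict Implicit.
Unset Printing Implicit Defensive.

Import GRing.Theory.
Local Open Scope ring_scope.

(* [Fps a] is the generating function of the sequence [a]. *)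
Record fps (K : fieldType) := Fps { coefs : nat -> K }.

Reserved Notation "[t^ n ] F" (at level 9, n at level 8, F at level 8,
  format "[t^ n ]  F").
Notation "[t^ n ] F" := (coefs F n) : ring_scope.

Section FpsRing.
Variable K : fieldType.
Implicit Types p q r : fps K.

HB.instance Definition _ := gen_eqMixin (fps K).
HB.instance Definition _ := gen_choiceMixin (fps K).

Lemma fpsP p q : (forall n, [t^n] p = [t^n] q) <-> p = q.
Proof.
split=> [|-> //]; case: p q => [a] [b] /= eqab.
by congr Fps; apply/funext.
Qed.

Definition fps_zero : fps K := Fps (fun=> 0).
Definition fps_opp p : fps K := Fps (fun n => - [t^n] p).
Definition fps_add p q : fps K := Fps (fun n => [t^n] p + [t^n] q).
Definition fpsC (c : K) : fps K := Fps (fun n => if n == 0%N then c else 0).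
Definition fps_mul p q : fps K :=
  Fps (fun n => \sum_(i < n.+1) [t^i] p * [t^(n - i)] q).

Fact fps_addA : associative fps_add.
Proof. by move=> p q r; apply/fpsP => n /=; rewrite addrA. Qed.
Fact fps_addC : commutative fps_add.
Proof. by move=> p q; apply/fpsP => n /=; rewrite addrC. Qed.
Fact fps_add0 : left_id fps_zero fps_add.
Proof. by move=> p; apply/fpsP => n /=; rewrite add0r. Qed.
Fact fps_addN : left_inverse fps_zero fps_opp fps_add.
Proof. by move=> p; apply/fpsP => n /=; rewrite addNr. Qed.

HB.instance Definition _ :=
  GRing.isZmodule.Build (fps K) fps_addA fps_addC fps_add0 fps_addN.

Let trunc m p : {poly K} := \poly_(i < m.+1) [t^i] p.

Let coef_trunc m p i : (i <= m)%N -> (trunc m p)`_i = [t^i] p.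
Proof. by move=> le_im; rewrite coef_poly ltnS le_im. Qed.

Let coef_mul_trunc m p q n :
  (n <= m)%N -> [t^n] (fps_mul p q) = (trunc m p * trunc m q)`_n.
Proof.
move=> le_nm; rewrite coefM; apply: eq_bigr => i _.
rewrite !coef_trunc ?(leq_trans (leq_subr _ _) le_nm) //.
by rewrite (leq_trans _ le_nm) // -ltnS.
Qed.

Fact fps_mulC : commutative fps_mul.
Proof.
by move=> p q; apply/fpsP => n; rewrite !(@coef_mul_trunc n) // mulrC.
Qed.

Fact fps_mulA : associative fps_mul.
Proof.
move=> p q r; apply/fpsP => n.
transitivity ((trunc n p * (trunc n q * trunc n r))`_n).
  rewrite coefM; apply: eq_bigr => i _.
  by rewrite coef_trunc -1?ltnS // -coef_mul_trunc ?leq_subr.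
rewrite mulrA coefM; apply: eq_bigr => i _.
by rewrite (coef_trunc _ (leq_subr _ _)) -coef_mul_trunc -1?ltnS.
Qed.

Fact fps_mul1 : left_id (fpsC 1) fps_mul.
Proof.
move=> p; apply/fpsP => n /=; rewrite big_ord_recl /= mul1r subn0.
by rewrite big1 ?addr0 // => i _; rewrite mul0r.
Qed.

Fact fps_mulDl : left_distributive fps_mul fps_add.
Proof.
move=> p q r; apply/fpsP => n /=; rewrite -big_split /=.
by apply: eq_bigr => i _; rewrite mulrDl.
Qed.

Fact fps_1neq0 : fpsC 1 != 0.
Proof.
apply/eqP => /fpsP/(_ 0%N) /= /eqP; exact/negP/oner_neq0.
Qed.

HB.instance Definition _ := GRing.Zmodule_isComNzRing.Build (fps K)
  fps_mulA fps_mulC fps_mul1 fps_mulDl fps_1neq0.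

Lemma coefs0 n : [t^n] (0 : fps K) = 0. Proof. by []. Qed.
Lemma coefs1 n : [t^n] (1 : fps K) = (n == 0%N)%:R.
Proof. by rewrite /=; case: eqP. Qed.
Lemma coefsD p q n : [t^n] (p + q) = [t^n] p + [t^n] q. Proof. by []. Qed.
Lemma coefsN p n : [t^n] (- p) = - [t^n] p. Proof. by []. Qed.
Lemma coefsB p q n : [t^n] (p - q) = [t^n] p - [t^n] q. Proof. by []. Qed.
Lemma coefsM p q n :
  [t^n] (p * q) = \sum_(i < n.+1) [t^i] p * [t^(n - i)] q.
Proof. by []. Qed.
Lemma coefs_sum I (s : seq I) (P : pred I) (F : I -> fps K) n :
  [t^n] (\sum_(i <- s | P i) F i) = \sum_(i <- s | P i) [t^n] (F i).
Proof. exact: (big_morph (fun p => [t^n] p)). Qed.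

Lemma coefsX_small p k n : [t^0] p = 0 -> (n < k)%N -> [t^n] (p ^+ k) = 0.
Proof.
move=> p0; elim: k n => // k IHk n lt_nk; rewrite exprS coefsM big_ord_recl.
rewrite p0 mul0r add0r big1 // => i _; rewrite IHk ?mulr0 //= /bump /= add1n.
case: n lt_nk i => [|n] lt_nk i; first by case: i.
by rewrite subSS (leq_ltn_trans (leq_subr _ _)).
Qed.

(* With q = 1 - c^-1 p and c = p(0), 1/p = c^-1 (1 + q + q^2 + ...), where only
   the terms up to q^n contribute to the coefficient of t^n.  As usual in the
   library, the inverse of a non-unit is itself. *)
Definition fps_unit : pred (fps K) := fun p => [t^0] p != 0.
Definition fps_inv p : fps K :=
  if fps_unit p then
    Fps (fun n => ([t^0] p)^-1 *
      \sum_(k < n.+1) [t^n] ((1 - fpsC ([t^0] p)^-1 * p) ^+ k))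
  else p.

Lemma coefsCM c p n : [t^n] (fpsC c * p) = c * [t^n] p.
Proof.
rewrite coefsM big_ord_recl /= subn0 big1 ?addr0 // => i _.
by rewrite mul0r.
Qed.

Fact fps_mulVx : {in fps_unit, left_inverse 1 fps_inv *%R}.
Proof.
move=> p; rewrite unfold_in => Up; rewrite /fps_inv [fps_unit p]Up.
set c := [t^0] p in Up *; set q := 1 - _; set v := Fps _.
have q0 : [t^0] q = 0 by rewrite coefsB coefsCM coefs1 mulVf ?subrr.
apply/fpsP => n; pose S := \sum_(k < n.+1) q ^+ k.
have vE i : (i <= n)%N -> [t^i] v = [t^i] (fpsC c^-1 * S).
  move=> le_in; rewrite coefsCM /S coefs_sum /=; congr (_ * _).
  rewrite -!(big_mkord xpredT (fun k => [t^i] (q ^+ k))).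
  rewrite [RHS](big_cat_nat (n := i.+1)) //= [X in _ = _ + X]big_nat_cond.
  rewrite [X in _ = _ + X]big1 ?addr0 // => k /andP[/andP[lt_ik _] _].
  exact: coefsX_small.
have ->: [t^n] (v * p) = [t^n] (fpsC c^-1 * S * p).
  by rewrite !coefsM; apply: eq_bigr => i _; rewrite vE // -ltnS.
have ->: fpsC c^-1 * S * p = 1 - q ^+ n.+1.
  rewrite mulrAC mulrC -(opprB (q ^+ _)) subrX1 -mulNr opprB mulrC.
  by rewrite /q opprB addrC subrK.
by rewrite coefsB (coefsX_small (k := n.+1)) ?subr0.
Qed.

Fact fps_unitPl p q : q * p = 1 -> fps_unit p.
Proof.
move/fpsP/(_ 0%N); rewrite coefsM big_ord1 coefs1 /= => qp1.
rewrite /fps_unit; apply: contraTneq isT => p0; move: qp1.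
by rewrite p0 mulr0 => /eqP; rewrite eq_sym oner_eq0.
Qed.

Fact fps_inv_out : {in [predC fps_unit], fps_inv =1 id}.
Proof. by move=> p; rewrite /fps_inv; case: ifP => // Up /negP[]. Qed.

HB.instance Definition _ := GRing.ComNzRing_hasMulInverse.Build (fps K)
  fps_mulVx fps_unitPl fps_inv_out.

Lemma fps_unitE p : (p \is a GRing.unit) = ([t^0] p != 0).
Proof. by []. Qed.

Fact fps_integral : GRing.integral_domain_axiom (fps K).
Proof.
have nz p : p != 0 ->
    exists2 m, [t^m] p != 0 & forall i, (i < m)%N -> [t^i] p = 0.
  move=> p_neq0; have ex_m : exists m, [t^m] p != 0.
    apply: contrapT => none; case/eqP: p_neq0; apply/fpsP => n.
    by apply: contrapT => /eqP pn; apply: none; exists n.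
  exists (ex_minn ex_m); case: ex_minnP => // m _ min_m i lt_im.
  by apply/eqP; apply: contraTT lt_im => /min_m; rewrite -leqNgt.
move=> p q pq0; apply/norP => -[/nz[m pm lt_m] /nz[n qn lt_n]].
have /fpsP/(_ (m + n)%N) := pq0; rewrite coefsM coefs0.
rewrite (bigD1 (inord m)) //= inordK ?ltnS ?leq_addr // addKn big1 => [|i].
  by move/eqP; rewrite addr0 mulf_eq0 (negPf pm) (negPf qn).
rewrite -val_eqE /= inordK ?ltnS ?leq_addr // => ne_im.
have [lt_im|le_mi] := ltnP i m; first by rewrite lt_m ?mul0r.
have lt_mi : (m < i)%N by rewrite ltn_neqAle eq_sym ne_im.
rewrite [X in _ * X]lt_n ?mulr0 // ltn_subLR ?ltn_add2r //.
by rewrite -ltnS ltn_ord.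
Qed.

HB.instance Definition _ :=
  GRing.ComUnitRing_isIntegral.Build (fps K) fps_integral.

Definition fpsT : fps K := Fps (fun n => (n == 1%N)%:R).

(* The composition p(u(t)), meaningful only when u(0) = 0: then u^k has no
   term of degree < k, so the sum over k may be cut at k = n. *)
Definition fps_comp p u : fps K :=
  Fps (fun n => \sum_(k < n.+1) [t^k] p * [t^n] (u ^+ k)).

Definition is_comp_inverse u w : Prop :=
  [/\ [t^0] u = 0, [t^0] w = 0, fps_comp u w = fpsT & fps_comp w u = fpsT].

Definition riordan_type_array (g f : fps K) (n k : nat) : K :=
  [t^n] (g * f ^+ k).

(* The condition under which (g, h) is called a Riordan array, in contrast to
   a Riordan type array: g(0) != 0, h(0) = 0 and h'(0) != 0.
   For h = tf the last condition says f(0) != 0, and it cannot be dropped where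
   tf has to be inverted: with f = t there is no series A with A(t^2) = t. *)
Definition is_riordan_pair (g h : fps K) : Prop :=
  [/\ [t^0] g != 0, [t^0] h = 0 & [t^1] h != 0].

Definition is_A_sequence (d : nat -> nat -> K) (a : nat -> K) : Prop :=
  forall n k : nat, (1 <= k)%N ->
    d n k = \sum_(0 <= j < n.+1) a j * d (n - j)%N (k + j - 1)%N.

Definition is_Z_sequence (d : nat -> nat -> K) (z : nat -> K) : Prop :=
  forall n : nat, (1 <= n)%N ->
    d n 0%N = \sum_(0 <= j < n) z j * d (n - j - 1)%N j.

End FpsRing.

Arguments fpsT {K}.
Notation "''t'" := fpsT (at level 0) : ring_scope.
Notation "p '\So' u" := (fps_comp p u) (at level 50) : ring_scope.
(* The embedding of K[[t]] in its field of fractions. *)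
Notation "p %:F" := (tofrac p) : ring_scope.

(* Main.v *)
Require Import Defs.
From mathcomp Require Import all_boot all_order all_algebra.

Set Implicit Arguments.
Unset Strict Implicit.
Unset Printing Implicit Defensive.

Import GRing.Theory.
Local Open Scope ring_scope.

(** Since [g] is a unit, the A-recurrence for [k = 1] is the coefficientwise
form of [g (f - A(tf)) = 0], and the recurrence for a larger [k] is the same
identity multiplied by [f^(k-1)]; the Z-recurrence is likewise
[g (1 - t Z(tf)) = g(0)]. Existence and uniqueness follow because [p |-> p(u)] is
a bijection of [K[[t]]] when [u = tf] with [f(0) <> 0]: the coefficients of the
preimage of [h] are the constant terms of the iterates of
[h |-> (h - h(0)) / u]. *)

(** * Coefficients and algebra of composition *)

Section FpsComposition.
Context {K : fieldType}.
Implicit Types (b c f h p q u v w x y : fps K) (n k : nat).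

Definition fps_shift p : fps K := Fps (fun n => [t^n.+1] p).

Lemma fpsT_neq0 : 't != 0 :> fps K.
Proof. by apply/eqP => /fpsP/(_ 1%N) /eqP; rewrite /= oner_eq0. Qed.

Lemma coefsTM p n : [t^n] ('t * p) = if n is m.+1 then [t^m] p else 0.
Proof.
case: n => [|n]; first by rewrite coefsM big_ord1 mul0r.
rewrite coefsM !big_ord_recl /= mul0r add0r mul1r subn1 /=.
by rewrite big1 ?addr0 // => i _; rewrite mul0r.
Qed.

Lemma coefsTXM k p n : [t^n] ('t ^+ k * p) = if (n < k)%N then 0 else [t^(n - k)] p.
Proof.
elim: k n => [|k IHk] n; first by rewrite mul1r subn0.
by rewrite exprS -mulrA coefsTM; case: n => // n; rewrite IHk ltnS subSS.
Qed.

Lemma fps_shiftE p : p = fpsC ([t^0] p) + 't * fps_shift p.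
Proof.
by apply/fpsP => -[|n]; rewrite coefsD coefsTM /= ?addr0 ?add0r.
Qed.

Lemma coefsM0 p q : [t^0] (p * q) = [t^0] p * [t^0] q.
Proof. by rewrite coefsM big_ord1. Qed.

(** Drives the inductions on the degree below: a factor without constant term makes the [n]-th
    coefficient depend only on lower ones. *)
Lemma eq_coefsMr v x y n : [t^0] v = 0 ->
  (forall i, (i < n)%N -> [t^i] x = [t^i] y) -> [t^n] (v * x) = [t^n] (v * y).
Proof.
move=> v0 eqxy; rewrite !coefsM !big_ord_recl v0 !mul0r; congr (_ + _).
apply: eq_bigr => i _; rewrite eqxy //= /bump /= add1n.
by case: n i {eqxy} => [[]//|n] i; rewrite subSS ltnS leq_subr.
Qed.

Lemma coefs_comp_widen p u n N : [t^0] u = 0 -> (n <= N)%N ->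
  [t^n] (p \So u) = \sum_(k < N.+1) [t^k] p * [t^n] (u ^+ k).
Proof.
move=> u0 le_nN; rewrite /= -!(big_mkord xpredT (fun k => [t^k] p * [t^n] (u ^+ k))).
rewrite [RHS](big_cat_nat (n := n.+1)) //= [X in _ = _ + X]big_nat_cond.
rewrite [X in _ = _ + X]big1 ?addr0 // => k /andP[/andP[lt_nk _] _].
by rewrite coefsX_small ?mulr0.
Qed.

Lemma coefsM_comp b p u n : [t^0] u = 0 ->
  [t^n] (b * (p \So u)) = \sum_(k < n.+1) [t^k] p * [t^n] (b * u ^+ k).
Proof.
move=> u0; rewrite coefsM.
under eq_bigr => i _ do
  rewrite (@coefs_comp_widen _ _ _ n) ?leq_subr // mulr_sumr.
rewrite exchange_big; apply: eq_bigr => k _.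
by rewrite coefsM mulr_sumr; apply: eq_bigr => i _; rewrite mulrCA.
Qed.

(** Since [(tf)^k = t^k f^k], the [k]-th term is read at degree [n - k]; this produces the index
    shift of the two recurrences. *)
Lemma coefsM_compTM b p f n :
  [t^n] (b * (p \So ('t * f))) = \sum_(k < n.+1) [t^k] p * [t^(n - k)] (b * f ^+ k).
Proof.
rewrite coefsM_comp ?coefsTM //; apply: eq_bigr => k _.
by rewrite exprMn mulrCA coefsTXM ltnNge -ltnS ltn_ord.
Qed.

Lemma comp_coef0 p u : [t^0] (p \So u) = [t^0] p.
Proof. by rewrite /= big_ord1 expr0 mulr1. Qed.

(** Horner step. It reduces identities between compositions to a constant term and a remainder
    multiplied by [u], to which [eq_coefsMr] applies. *)
Lemma comp_shift p u : [t^0] u = 0 ->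
  p \So u = fpsC ([t^0] p) + u * (fps_shift p \So u).
Proof.
move=> u0; apply/fpsP => n.
(* Cutting at [n + 1] instead of [n] leaves, once [k = 0] is split off, exactly the [n + 1] terms of
   the product with [u]. *)
rewrite coefsD coefsM_comp // (@coefs_comp_widen _ _ _ n.+1) //.
rewrite big_ord_recl expr0 coefs1; congr (_ + _).
  by rewrite /=; case: eqP => _; rewrite ?mulr1 ?mulr0.
by apply: eq_bigr => k _; rewrite exprS.
Qed.

Lemma comp_fpsD p q u : (p + q) \So u = (p \So u) + (q \So u).
Proof.
by apply/fpsP => n; rewrite /= -big_split; apply: eq_bigr => k _; rewrite mulrDl.
Qed.

Lemma comp_fpsC (c : K) u : fpsC c \So u = fpsC c.
Proof.
apply/fpsP => n; rewrite /= big_ord_recl big1 => [|k _]; last by rewrite mul0r.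
by rewrite addr0 expr0 coefs1 /=; case: eqP => _; rewrite ?mulr1 ?mulr0.
Qed.

Lemma comp_fpsCM (c : K) p u : (fpsC c * p) \So u = fpsC c * (p \So u).
Proof.
apply/fpsP => n; rewrite coefsCM /= mulr_sumr.
by apply: eq_bigr => k _; rewrite [RHS]mulrA -(coefsCM c p).
Qed.

Lemma comp_TM p u : [t^0] u = 0 -> ('t * p) \So u = u * (p \So u).
Proof.
move=> u0; rewrite comp_shift // coefsTM.
have ->: fpsC 0 = 0 :> fps K by apply/fpsP => n /=; case: eqP.
by rewrite add0r; congr (_ * (_ \So _)); apply/fpsP => n; apply: coefsTM.
Qed.

Lemma comp_fpsTl u : [t^0] u = 0 -> 't \So u = u.
Proof. by move=> u0; rewrite -['t]mulr1 comp_TM // comp_fpsC mulr1. Qed.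

Lemma comp_fpsM p q u : [t^0] u = 0 -> (p * q) \So u = (p \So u) * (q \So u).
Proof.
move=> u0; apply/fpsP => n; elim/ltn_ind: n p => n IHn p.
rewrite {1}(fps_shiftE p) (comp_shift p) // !mulrDl -!mulrA comp_fpsD.
rewrite comp_fpsCM comp_TM // !coefsD; congr (_ + _).
by apply: eq_coefsMr => // i /IHn.
Qed.

Lemma comp_fpsA p u w : [t^0] u = 0 -> [t^0] w = 0 ->
  (p \So u) \So w = p \So (u \So w).
Proof.
move=> u0 w0; have uw0 : [t^0] (u \So w) = 0 by rewrite comp_coef0.
apply/fpsP => n; elim/ltn_ind: n p => n IHn p.
rewrite (comp_shift p) // (comp_shift p) // comp_fpsD comp_fpsC comp_fpsM //.
by rewrite !coefsD; congr (_ + _); apply: eq_coefsMr => // i /IHn.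
Qed.

(** * Bijectivity of composition with [tf], and compositional inverses *)

Lemma comp_TM_inj f p q : [t^0] f != 0 ->
  p \So ('t * f) = q \So ('t * f) -> p = q.
Proof.
move=> f0 /fpsP eqpq; apply/fpsP; elim/ltn_ind => n IHn.
have:= eqpq n; rewrite /= !big_ord_recr /=.
under eq_bigr => k _ do rewrite IHn //.
(* The system is triangular: the coefficients below [n] agree, and the diagonal entry [[t^n] (tf)^n
   = f(0)^n] is nonzero. *)
move/addrI; apply: mulIf.
rewrite exprMn coefsTXM ltnn subnn.
by elim: n {IHn} => [|n IHn]; rewrite ?oner_neq0 // exprS coefsM0 mulf_neq0.
Qed.

Lemma comp_TM_surj f h : [t^0] f != 0 -> exists p, p \So ('t * f) = h.
Proof.
(* [S x] is [(x - x(0)) / (tf)]: the shift divides by [t], and [f] is a unit. *)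
rewrite -fps_unitE => Uf; pose S x := fps_shift x / f.
have SE x : x = fpsC ([t^0] x) + 't * f * S x.
  by rewrite -mulrA [f * _]mulrCA divrr // mulr1 -fps_shiftE.
exists (Fps (fun n => [t^0] (iter n S h))); set p := Fps _; set u := 't * f.
have hE n : h = \sum_(k < n) fpsC ([t^k] p) * u ^+ k + u ^+ n * iter n S h.
  elim: n => [|n IHn]; first by rewrite big_ord0 add0r mul1r.
  rewrite big_ord_recr {1}IHn /= {1}(SE (iter n S h)) mulrDr addrA.
  by rewrite [in fpsC _ * _]mulrC exprSr mulrA.
(* After [n + 1] steps the remainder is divisible by [t^(n+1)] and cannot reach degree [n]. *)
apply/fpsP => n; rewrite [in RHS](hE n.+1) coefsD exprMn -mulrA coefsTXM ltnSn addr0.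
by rewrite coefs_sum; apply: eq_bigr => k _; rewrite coefsCM.
Qed.

Lemma comp_fpsTr p : p \So 't = p.
Proof.
apply/fpsP => n; elim/ltn_ind: n p => n IHn p.
rewrite comp_shift // [in RHS](fps_shiftE p) !coefsD; congr (_ + _).
by apply: eq_coefsMr => // i /IHn.
Qed.

Lemma comp_inverse_inj u w p q : is_comp_inverse u w ->
  p \So u = q \So u -> p = q.
Proof.
case=> u0 w0 uw _ /(congr1 (fun r => r \So w)).
by rewrite !comp_fpsA // uw !comp_fpsTr.
Qed.

Lemma comp_inverse_TM_exists f : [t^0] f != 0 ->
  exists w, is_comp_inverse ('t * f) w.
Proof.
move=> f0; have u0 : [t^0] ('t * f) = 0 by rewrite coefsTM.
have [w wu] := comp_TM_surj 't f0.
have w0 : [t^0] w = 0 by rewrite -(comp_coef0 w ('t * f)) wu.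
(* With [u = tf], the other side follows by cancelling [u] on the right in
   [(u o w) o u = u o (w o u) = u = t o u]. *)
exists w; split=> //; apply: (comp_TM_inj f0).
by rewrite comp_fpsA // wu comp_fpsTr comp_fpsTl.
Qed.

End FpsComposition.

(** * Recurrences as functional equations *)

Section RiordanSequences.
Context {K : fieldType} (g f : fps K).
Hypothesis g0 : [t^0] g != 0.
Let d := riordan_type_array g f.
Let Ug : g \is a GRing.unit. Proof. by rewrite fps_unitE. Qed.

Lemma coefs_riordan_comp p n k :
  [t^n] (g * f ^+ k * (p \So ('t * f))) =
  \sum_(0 <= j < n.+1) [t^j] p * d (n - j) (k + j).
Proof.
rewrite coefsM_compTM big_mkord.
by apply: eq_bigr => j _; rewrite -mulrA -exprD.
Qed.

Lemma A_sequenceP a : is_A_sequence d a <-> Fps a \So ('t * f) = f.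
Proof.
split=> [Aa|fE n [//|k] _].
  apply: (mulrI Ug); apply/fpsP => n.
  have:= coefs_riordan_comp (Fps a) n 0; rewrite expr0 mulr1 => ->.
  rewrite -[f in RHS]expr1 [RHS](Aa n 1%N) //.
  by apply: eq_bigr => j _; rewrite add1n subn1.
rewrite /d /riordan_type_array exprSr mulrA -[f in _ * f]fE coefs_riordan_comp.
by apply: eq_bigr => j _; rewrite addSn subn1.
Qed.

(** Division-free form of the equation for [Z], affine in [Z(tf)], from which both the quotient
    formula and unique solvability are derived. *)
Lemma Z_sequence_mulP z :
  is_Z_sequence d z <-> g = fpsC ([t^0] g) + 't * (g * (Fps z \So ('t * f))).
Proof.
have cE n : [t^n] (g * (Fps z \So ('t * f))) =
    \sum_(0 <= j < n.+1) z j * d (n.+1 - j - 1) j.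
  have:= coefs_riordan_comp (Fps z) n 0; rewrite expr0 mulr1 => ->.
  by apply: eq_bigr => j _; rewrite subnAC subn1.
have dE n : d n 0 = [t^n] g by rewrite /d /riordan_type_array expr0 mulr1.
split=> [Zz|gE [//|n] _]; last by rewrite dE {1}gE coefsD coefsTM cE add0r.
(* Degree [0] holds by itself, which matches a recurrence starting at [n = 1]. *)
apply/fpsP => -[|n]; rewrite coefsD coefsTM ?addr0 // add0r cE -dE.
exact: Zz.
Qed.

Lemma Z_sequenceP z :
  is_Z_sequence d z <->
  g = fpsC (d 0 0) / (1 - 't * (Fps z \So ('t * f))).
Proof.
have ->: d 0 0 = [t^0] g by rewrite /d /riordan_type_array expr0 mulr1.
apply: (iff_trans (Z_sequence_mulP z)); set Z := Fps z \So _.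
(* The constant term is [1], so the quotient is a genuine one and not the default inverse of a
   non-unit. *)
have UZ : 1 - 't * Z \is a GRing.unit.
  by rewrite fps_unitE coefsB coefsTM subr0 coefs1 oner_neq0.
have gZ : g * (1 - 't * Z) = g - 't * (g * Z) by rewrite mulrBr mulr1 mulrCA.
split=> [gE | /(canLR (divrK UZ))]; last first.
  by rewrite gZ => /(canRL (subrK _)).
by apply: (canRL (mulrK UZ)); rewrite gZ; apply: (canLR (addrK _)).
Qed.

Lemma A_sequence_exists_unique :
  [t^0] f != 0 -> exists! a : nat -> K, is_A_sequence d a.
Proof.
move=> f0; have [p pE] := comp_TM_surj f f0; exists (coefs p); split.
  by apply/A_sequenceP; case: p pE.
by move=> a /A_sequenceP aE; rewrite (comp_TM_inj f0 (etrans pE (esym aE))).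
Qed.

Lemma Z_sequence_exists_unique :
  [t^0] f != 0 -> exists! z : nat -> K, is_Z_sequence d z.
Proof.
(* Solving [g = g(0) + t g Z(tf)] forces [Z(tf) = (g - g(0)) / (t g)]. *)
move=> f0; have [p pE] := comp_TM_surj (fps_shift g / g) f0.
have gE : g = fpsC ([t^0] g) + 't * (g * (p \So ('t * f))).
  by rewrite pE [g * _]mulrCA divrr // mulr1 -fps_shiftE.
exists (coefs p); split; first by apply/Z_sequence_mulP; case: p {pE} gE.
move=> z /Z_sequence_mulP; rewrite {1}gE => /addrI.
by move/(mulfI fpsT_neq0)/(mulrI Ug)/(comp_TM_inj f0) => ->.
Qed.

End RiordanSequences.

(** As [w(0) = 0], the quotient [t / w] is taken in the fraction field. Both sides amount to
    [p w = t], which composed with [tf] reads [p(tf) t = tf]. *)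
Lemma A_seriesP (K : fieldType) (f w p : fps K) : is_comp_inverse ('t * f) w ->
  p \So ('t * f) = f <-> p%:F = 't%:F / w%:F.
Proof.
move=> inv_w; have [u0 _ _ wu] := inv_w.
have w0 : w%:F != 0.
  rewrite tofrac_eq0; apply: contraNneq (@fpsT_neq0 K) => w0; apply/eqP; rewrite -wu w0.
  by apply/fpsP => n /=; rewrite big1 // => k _; rewrite mul0r.
apply: (@iff_trans _ (p * w = 't)).
  split=> [pf | pw].
    by apply: (comp_inverse_inj inv_w); rewrite comp_fpsM // pf wu comp_fpsTl // mulrC.
  by have:= comp_fpsTl u0; rewrite -{1}pw comp_fpsM // wu mulrC => /(mulfI fpsT_neq0).
split=> [<- | pE]; first by rewrite tofracM mulfK.
by apply/eqP; rewrite -tofrac_eq tofracM pE divfK.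
Qed.

Theorem theorem3p2 (K : fieldType) (charK : [pchar K] =i pred0)
    (g f : fps K) (g0 : [t^0] g != 0) :
  let d := riordan_type_array g f in
  (* (a) *)
  ([/\ is_riordan_pair g ('t * f) -> exists! a : nat -> K, is_A_sequence d a,
       forall a : nat -> K, is_A_sequence d a <-> Fps a \So ('t * f) = f,
       is_riordan_pair g ('t * f) ->
         exists! w : fps K, is_comp_inverse ('t * f) w
     & forall (a : nat -> K) (w : fps K), is_comp_inverse ('t * f) w ->
         (Fps a \So ('t * f) = f <-> (Fps a)%:F = 't%:F / w%:F)])
  /\
  (* (b) *)
  ((is_riordan_pair g ('t * f) -> exists! z : nat -> K, is_Z_sequence d z) /\
   (forall z : nat -> K,
      is_Z_sequence d z <->
      g = fpsC (d 0%N 0%N) / (1 - 't * (Fps z \So ('t * f))))).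
Proof.
(* The linear coefficient of [tf] is [f(0)]. *)
have f0P : is_riordan_pair g ('t * f) -> [t^0] f != 0.
  by case=> _ _; rewrite coefsTM.
split; last split=> [/f0P|z].
- split=> [/f0P|a|/f0P f0|a w].
  + exact: A_sequence_exists_unique.
  + exact: A_sequenceP.
  + have [w inv_w] := comp_inverse_TM_exists f0; exists w; split=> // v [_ _ _ vu].
    by case: inv_w => _ _ _ wu; apply: (comp_TM_inj f0); rewrite wu.
  + exact: A_seriesP.
- exact: Z_sequence_exists_unique.
- exact: Z_sequenceP.
Qed.
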